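(* Let $a,b\in F(P_\omega)$ and $\lambda,\mu\in\mathbb{T}\setminus\{1\}$. Then the product of $x_\lambda a$ and $bx_\mu$ in the peripheral Poisson boundary is $$(x_\lambda a)\circ(bx_\mu)=x_\lambda\,(a\circ b)\,x_\mu .$$
   Context: $H$ is a separable Hilbert space with orthonormal basis $\{e_i: i\in\Theta\}$, where $\Theta=\{1,\dots,n\}$ with $n>1$, or $\Theta=\mathbb{N}$. $\mathcal{F}(H)=\bigoplus_{n\ge 0}H^{\otimes n}$ is the full Fock space, with $H^{\otimes 0}=\mathbb{C}\Omega$, $\Omega$ a unit (vacuum) vector. For $\xi\in H$, $l_\xi$ is the left creation operator on $\mathcal{F}(H)$, $l_\xi(\eta)=\xi\otimes\eta$ (with $l_\xi\Omega=\xi$), and $l_i=l_{e_i}$. $\omega=(\omega_i)_{i\in\Theta}$ is a family of positive reals with $\sum_{i\in\Theta}\omega_i=1$, and $P_\omega:B(\mathcal{F}(H))\to B(\mathcal{F}(H))$ is the normal unital completely positive map $P_\omega(x)=\sum_{i\in\Theta}\omega_i\, l_i^*xl_i$. For $\lambda\in\mathbb{T}$ (unit circle), $E_\lambda(P_\omega)=\{x: P_\omega(x)=\lambda x\}$. The Poisson boundary is $F(P_\omega)=E_1(P_\omega)$. The peripheral Poisson boundary $P(P_\omega)$ is the norm-closed linear span in $B(\mathcal F(H))$ of $\bigcup_{\lambda\in\mathbb{T}}E_\lambda(P_\omega)$. It is known (Bhat–Kar–Talwar) that $P(P_\omega)$ is a unital C*-algebra with the operator norm, the usual adjoint, unit $1$,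 and the modified Choi–Effros product $\circ$, the unique norm-continuous bilinear map on $P(P_\omega)$ such that $x\circ y=\text{SOT-}\lim_{m\to\infty}(\lambda\mu)^{-m}P_\omega^m(xy)$ for $x\in E_\lambda(P_\omega)$, $y\in E_\mu(P_\omega)$. For $\lambda\in\mathbb{T}\setminus\{1\}$, $x_\lambda\in B(\mathcal{F}(H))$ is the unitary acting as multiplication by $\lambda^n$ on $H^{\otimes n}$, $n\ge 0$. The elements $x_\lambda a$ and $bx_\mu$ lie in $E_\lambda(P_\omega)$ and $E_\mu(P_\omega)$ respectively. Juxtaposition denotes the usual operator product in $B(\mathcal{F}(H))$. *)

(* Defs.v *)
From HB Require Import structures.
From mathcomp Require Import all_boot all_order all_algebra.
From mathcomp Require Import all_classical all_reals all_analysis.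
From mathcomp Require Import complex.

Set Implicit Arguments.
Unset Strict Implicit.
Unset Printing Implicit Defensive.

Import Order.TTheory GRing.Theory Num.Theory.
Import numFieldNormedType.Exports.

Local Open Scope classical_set_scope.
Local Open Scope complex_scope.
Local Open Scope ring_scope.

HB.mixin Record CompleteNormedModule_isHilbert (R : realType) (V : Type)
    of CompleteNormedModule R[i] V := {
  inner : {dot V for (@Num.conj R[i])};
  inner_normE : forall x : V, `|x| ^+ 2 = inner x x }.

#[short(type="hilbertType")]
HB.structure Definition Hilbert (R : realType) :=
  {V of CompleteNormedModule R[i] V & CompleteNormedModule_isHilbert R V}.

Section linear_span.
Context {K : numFieldType} {V : lmodType K}.

Definition lspan (A : set V) : set V :=
  [set v | exists (n : nat) (c : 'I_n -> K) (a : 'I_n -> V),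
     (forall i, A (a i)) /\ v = \sum_(i < n) c i *: a i].

End linear_span.

Section bounded_operators.
Context {R : realType} (V : normedModType R[i]).
Local Notation C := R[i].

Definition is_bop : {pred V -> V} := [pred f | `[< linear f /\ continuous f >]].

Record bop := Bop { bop_fun :> V -> V; bopP : bop_fun \in is_bop }.

HB.instance Definition _ := [isSub for bop_fun].
HB.instance Definition _ := [Choice of bop by <:].

Lemma is_bopP (f : V -> V) :
  reflect (linear f /\ continuous f) (f \in is_bop).
Proof. by apply: (iffP idP) => [|H]; rewrite inE => //; exact/asboolP. Qed.

Lemma is_bop_submod_closed : submod_closed is_bop.
Proof.
split.
  apply/is_bopP; split => [a x y|x].
    by rewrite /= scaler0 addr0.
  exact: cst_continuous.
move=> a f g /is_bopP[fl fc] /is_bopP[gl gc]; apply/is_bopP; split.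
  move=> b x y; rewrite /= !fctE fl gl !scalerDr !scalerA (mulrC a b).
  by rewrite -!addrA; congr (_ + _); rewrite addrCA.
move=> x; apply: cvgD; last exact: gc.
by apply: cvgZl_tmp; exact: fc.
Qed.

HB.instance Definition _ :=
  GRing.isSubmodClosed.Build C (V -> V) is_bop
    (GRing.submod_closed_semi is_bop_submod_closed).
HB.instance Definition _ := [SubChoice_isSubLmodule of bop by <:].

Implicit Types (A B : bop) (v : V).

Lemma bop_eq A B : (forall v, A v = B v) -> A = B.
Proof. by move=> AB; apply: val_inj; apply/funext. Qed.

Lemma bop_linear A : linear A. Proof. by case/is_bopP: (bopP A). Qed.

Lemma bop_continuous A : continuous A. Proof. by case/is_bopP: (bopP A). Qed.

HB.instance Definition _ A := GRing.isLinear.Build C V V *:%R A (bop_linear A).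

Lemma bop0E v : (0 : bop) v = 0. Proof. by []. Qed.
Lemma bopDE A B v : (A + B) v = A v + B v. Proof. by []. Qed.
Lemma bopZE (a : C) A v : (a *: A) v = a *: A v. Proof. by []. Qed.

Lemma bop_one_subproof : (idfun : V -> V) \in is_bop.
Proof. by apply/is_bopP; split => // x; exact: cvg_id. Qed.

Lemma bop_mul_subproof A B : (A \o B : V -> V) \in is_bop.
Proof.
apply/is_bopP; split => [a x y|x]; first by rewrite /= !bop_linear.
by apply: continuous_comp; exact: bop_continuous.
Qed.

Definition bop_one : bop := Bop bop_one_subproof.
Definition bop_mul A B : bop := Bop (bop_mul_subproof A B).

Lemma bop_mulA : associative bop_mul.
Proof. by move=> A B D; apply: bop_eq. Qed.
Lemma bop_mul1 : left_id bop_one bop_mul.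
Proof. by move=> A; apply: bop_eq. Qed.
Lemma bop_mulr1 : right_id bop_one bop_mul.
Proof. by move=> A; apply: bop_eq. Qed.
Lemma bop_mulDl : left_distributive bop_mul +%R.
Proof. by move=> A B D; apply: bop_eq. Qed.
Lemma bop_mulDr : right_distributive bop_mul +%R.
Proof.
move=> A B D; apply: bop_eq => v /=.
exact: raddfD.
Qed.

(* x * y is the composition of operators; the ring is trivial when V is 0 *)
HB.instance Definition _ := GRing.Zmodule_isPzRing.Build bop
  bop_mulA bop_mul1 bop_mulr1 bop_mulDl bop_mulDr.

Definition opnorm A : C :=
  (sup [set complex.Re `|A v| | v in [set v | `|v| <= 1]])%:C.

Lemma bop_bounded A : exists2 M : C, 0 < M & forall v, `|A v| <= M * `|v|.
Proof.
have /linear_bounded_continuous/linear_boundedP : continuous A.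
  exact: bop_continuous.
by move=> /pinfty_ex_gt0 [M M0 AM]; exists M.
Qed.

Let norm_RRe (x : V) : (complex.Re `|x|)%:C = `|x|.
Proof. by rewrite RRe_real// ger0_real. Qed.

Let has_sup_opnorm A :
  has_sup [set complex.Re `|A v| | v in [set v | `|v| <= 1]].
Proof.
split; first by exists (complex.Re `|A 0|), 0 => //=; rewrite normr0.
have [M M0 AM] := bop_bounded A; exists (complex.Re M) => _ [v /= v1 <-].
rewrite -lecR norm_RRe RRe_real ?gtr0_real// (le_trans (AM v))//.
by rewrite ler_piMr// ltW.
Qed.

Lemma opnormP A v : `|A v| <= opnorm A * `|v|.
Proof.
have [->|v0] := eqVneq v 0; first by rewrite linear0 !normr0 mulr0.
rewrite -ler_pdivrMr ?normr_gt0// mulrC.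
have -> : `|v|^-1 * `|A v| = `|A (`|v|^-1 *: v)|.
  by rewrite linearZ normrZ normfV normr_id.
rewrite /opnorm -norm_RRe lecR; apply: ub_le_sup.
  by case: (has_sup_opnorm A).
exists (`|v|^-1 *: v) => //=.
by rewrite normrZ normfV normr_id mulVf// normr_eq0.
Qed.

Lemma opnorm_le A (M : C) :
  0 <= M -> (forall v, `|A v| <= M * `|v|) -> opnorm A <= M.
Proof.
move=> M0 AM; rewrite /opnorm -[leRHS]RRe_real ?ger0_real// lecR.
apply: ge_sup; first by case: (has_sup_opnorm A).
move=> _ [v /= v1 <-].
rewrite -lecR norm_RRe RRe_real ?ger0_real// (le_trans (AM v))//.
by rewrite ler_piMr.
Qed.

Lemma opnorm_ge0 A : 0 <= opnorm A.
Proof.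
rewrite /opnorm -[0]/(0%:C) lecR.
apply: ub_le_sup; first by case: (has_sup_opnorm A).
by exists 0; rewrite /= ?normr0 ?linear0 ?normr0.
Qed.

Lemma ler_opnormD A B : opnorm (A + B) <= opnorm A + opnorm B.
Proof.
apply: opnorm_le => [|v]; first by rewrite addr_ge0// opnorm_ge0.
rewrite mulrDl bopDE (le_trans (ler_normD _ _))// lerD// opnormP //.
Qed.

Lemma ler_opnormZ (a : C) A : opnorm (a *: A) <= `|a| * opnorm A.
Proof.
apply: opnorm_le => [|v]; first by rewrite mulr_ge0// opnorm_ge0.
by rewrite bopZE normrZ -mulrA ler_wpM2l// opnormP.
Qed.

Lemma opnormZ (a : C) A : opnorm (a *: A) = `|a| * opnorm A.
Proof.
apply/le_anti; rewrite ler_opnormZ/=.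
have [->|a0] := eqVneq a 0; first by rewrite normr0 mul0r opnorm_ge0.
rewrite -ler_pdivlMl ?normr_gt0//.
by rewrite -{1}[A](scalerK a0) -normfV ler_opnormZ.
Qed.

Lemma opnorm0_eq0 A : opnorm A = 0 -> A = 0.
Proof.
move=> A0; apply: bop_eq => v; apply/eqP; rewrite bop0E -normr_le0.
by have := opnormP A v; rewrite A0 mul0r.
Qed.

HB.instance Definition _ := Lmodule_isNormed.Build C bop
  ler_opnormD opnormZ opnorm0_eq0.

End bounded_operators.

Section hilbert_operators.
Context {R : realType} {V : hilbertType R}.

(* the inner product, linear in its first argument *)
Definition dotp (x y : V) : R[i] := @inner R V x y.

(* The (unique) adjoint of A; the default value of get is never used, since
   adjoints exist by the Riesz representation theorem. *)
Definition adjoint (A : bop V) : bop V :=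
  get [set B : bop V | forall u v, dotp (A u) v = dotp u (B v)].

Definition sot_cvg (A : nat -> bop V) (B : bop V) : Prop :=
  forall v, A m v @[m --> \oo] --> B v.

Definition orthonormal_basis (I : set nat) (e : nat -> V) : Prop :=
  (forall i j, I i -> I j -> dotp (e i) (e j) = (i == j)%:R) /\
  closure (lspan (e @` I)) = setT.

End hilbert_operators.

(* The full Fock space over H, up to unitary isomorphism: [tens [:: x1; ..; xn]]
   is the simple tensor x1 (x) .. (x) xn of the n-th summand, and [tens [::]] is
   the vacuum vector. The inner product formula states at once that the summands
   are mutually orthogonal and that each carries the tensor product inner
   product. *)
Record fockSpace (R : realType) (H : hilbertType R) := FockSpace {
  fock_sort :> hilbertType R;
  tens : seq H -> fock_sort;
  tens_linear : forall (s t : seq H) (a : R[i]) (x y : H),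
    tens (s ++ (a *: x + y) :: t) =
    a *: tens (s ++ x :: t) + tens (s ++ y :: t);
  tens_dot : forall s t : seq H,
    dotp (tens s) (tens t) =
    if size s == size t then \prod_(p <- zip s t) dotp p.1 p.2 else 0;
  tens_total : closure (lspan (range tens)) = setT }.

Arguments tens {R H} f s.

Section fock_operators.
Context {R : realType} {H : hilbertType R} (F : fockSpace H).
Local Notation C := R[i].

(* the summand H^{(x) n} of F *)
Definition tensor_power (n : nat) : set F :=
  closure (lspan [set tens F s | s in [set s | size s = n]]).

(* As for adjoint, [creation x] and [gauge lambda] (|lambda| = 1) are the
   unique bounded operators satisfying the given conditions. *)
Definition creation (x : H) : bop F :=
  get [set L : bop F | forall s, L (tens F s) = tens F (x :: s)].

Definition gauge (lambda : C) : bop F :=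
  get [set X : bop F |
    forall n v, tensor_power n v -> X v = lambda ^+ n *: v].

Context (Theta : set nat) (e : nat -> H) (omega : nat -> R).

(* limit in operator norm of the partial sums *)
Definition markov_op (x : bop F) : bop F :=
  limn (fun n => \sum_(0 <= i < n | i \in Theta)
    (omega i)%:C *: (adjoint (creation (e i)) * x * creation (e i))).

End fock_operators.

Arguments tensor_power {R H} F n.
Arguments creation {R H} F x.
Arguments gauge {R H} F lambda.
Arguments markov_op {R H} F Theta e omega x.

Section peripheral_boundary.
Context {R : realType} {F : hilbertType R} (P : bop F -> bop F).
Local Notation C := R[i].

Definition eigenop (lambda : C) : set (bop F) :=
  [set x | P x = lambda *: x].

Definition poisson_boundary : set (bop F) := eigenop 1.

Definition peripheral_boundary : set (bop F) :=
  closure (lspan (\bigcup_(lambda in [set z : C | `|z| = 1]) eigenop lambda)).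

(* circ is the modified Choi-Effros product; only its values on the peripheral
   Poisson boundary are specified, where they are uniquely determined. *)
Record is_peripheral_product (circ : bop F -> bop F -> bop F) : Prop := {
  circ_closed : forall x y, peripheral_boundary x -> peripheral_boundary y ->
    peripheral_boundary (circ x y);
  circ_linearl : forall (a : C) x y z, peripheral_boundary x ->
    peripheral_boundary y -> peripheral_boundary z ->
    circ (a *: x + y) z = a *: circ x z + circ y z;
  circ_linearr : forall (a : C) x y z, peripheral_boundary x ->
    peripheral_boundary y -> peripheral_boundary z ->
    circ z (a *: x + y) = a *: circ z x + circ z y;
  circ_continuous :
    {within peripheral_boundary `*` peripheral_boundary,
      continuous (fun p : bop F * bop F => circ p.1 p.2)};
  circ_sot : forall (lambda mu : C) x y, `|lambda| = 1 -> `|mu| = 1 ->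
    eigenop lambda x -> eigenop mu y ->
    sot_cvg (fun m => (lambda * mu) ^- m *: iter m P (x * y)) (circ x y) }.

End peripheral_boundary.

(* Main.v *)
Require Import Defs.
From HB Require Import structures.
From mathcomp Require Import all_boot all_order all_algebra.
From mathcomp Require Import all_classical all_reals all_analysis.
From mathcomp Require Import complex.

(** On simple tensors one checks that [x_lambda l_i = lambda l_i x_lambda] and
    [l_i^* x_lambda = lambda x_lambda l_i^*]. Hence
    [P (x_lambda A x_mu) = lambda mu x_lambda (P A) x_mu] for every operator [A],
    so that [(lambda mu)^-m P^m (x_lambda a b x_mu) = x_lambda P^m(a b) x_mu], and
    both sides of the theorem are strong limits of this sequence. *)

Import Order.TTheory GRing.Theory Num.Theory.
Import numFieldNormedType.Exports.

Local Open Scope classical_set_scope.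
Local Open Scope complex_scope.
Local Open Scope ring_scope.

Set Implicit Arguments.
Unset Strict Implicit.
Unset Printing Implicit Defensive.

(** * Extension by density of a bounded linear relation *)

Section contraction_extension.
Context {K : numFieldType} {V : normedModType K} {W : completeNormedModType K}.
(** [G] is the graph of a densely defined operator. It is a relation because a formula on linear
    combinations is not visibly a function of the vector they sum to; [G_bounded] makes it
    single-valued. *)
Variables (G : V -> W -> Prop) (M : K).
Hypothesis M_gt0 : 0 < M.
Hypothesis G_linear : forall (c : K) v w v' w',
  G v w -> G v' w' -> G (c *: v + v') (c *: w + w').
Hypothesis G_bounded : forall v w, G v w -> `|w| <= M * `|v|.
Hypothesis G_dense : closure [set v | exists w, G v w] = setT.

Let G_near (v : V) (eps : K) : 0 < eps ->
  exists u w, G u w /\ `|v - u| < eps.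
Proof.
move=> eps0; have /(_ (ball v eps)) : closure [set v | exists w, G v w] v.
  by rewrite G_dense.
move=> /(_ (nbhsx_ballx _ _ eps0))[u [/= [w Guw]]].
by rewrite -ball_normE/= => uv; exists u, w.
Qed.

Let G_dist u w u' w' : G u w -> G u' w' -> `|w - w'| <= M * `|u - u'|.
Proof.
move=> Guw Guw'; have := G_bounded (G_linear (-1) Guw' Guw).
by rewrite !scaleN1r ![- _ + _]addrC.
Qed.

(* The value at [v] is the limit of [w] along the pairs [G u w] with [u] close to
   [v]. *)
Let value_exists (v : V) :
  exists w, forall u w', G u w' -> `|w - w'| <= M * `|v - u|.
Proof.
pose F : set_system W := fun A => \forall u \near v, forall w, G u w -> A w.
have FF : ProperFilter F.
  split.
    rewrite /F => /nbhs_ballP[eps /= eps0] F0.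
    have [u [w [Guw uv]]] := G_near v eps0.
    by apply: (F0 u _ w Guw); rewrite -ball_normE.
  split; first exact: nearW.
    move=> A B; rewrite /F => FA FB; near=> u => w Guw.
    by split; [exact: (near FA u)|exact: (near FB u)].
  move=> A B AB; rewrite /F; apply: filterS => u + w Guw.
  by move=> /(_ w Guw)/AB.
have FE (eps : K) (u : V) w : 0 < eps -> G u w ->
    F (fun w' => `|w - w'| <= M * (`|v - u| + eps)).
  move=> eps0 Guw; apply/nbhs_ballP; exists eps => //= u'.
  rewrite -ball_normE/= => vu' w' Guw'.
  rewrite (le_trans (G_dist Guw Guw'))// ler_pM2l//.
  rewrite (le_trans (ler_distD v _ _))// (distrC u) lerD// ltW//.
have : cvg F.
  apply/cauchy_cvgP; apply: cauchy_exP => eps eps0.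
  (* Both [|v - u|] and the radius in [FE] stay below a third of [eps / M], so the bound of [FE] is
     below [eps]. *)
  have d0 : 0 < eps / M / 3%:R by rewrite !divr_gt0.
  have [u [w [Guw vu]]] := G_near v d0.
  exists w; apply: filterS (FE _ _ _ d0 Guw) => w'.
  rewrite -ball_normE/= => /le_lt_trans; apply.
  rewrite -ltr_pdivlMl// [M^-1 * _]mulrC.
  rewrite [ltRHS](_ : _ = eps / M / 3%:R + eps / M / 3%:R + eps / M / 3%:R).
    rewrite -[in ltRHS]addrA; apply: ltr_leD => //.
    by rewrite lerDl ltW.
  by rewrite -mulr2n -mulrSr -[RHS]mulr_natr divfK// pnatr_eq0.
move=> /cvg_ex[w Fw]; exists w => u w' Guw'.
apply/ler_addgt0Pr => eps eps0.
(* With [d] this quotient, the two errors [d] and [M * d] add up to [eps]. *)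
have d0 : 0 < eps / (1 + M) by rewrite divr_gt0// addr_gt0.
have wF : F (fun w'' => `|w - w''| < eps / (1 + M)).
  by apply: Fw; apply/nbhs_ballP; exists (eps / (1 + M)) => //=; rewrite -ball_normE.
have [w'' [w1 w2]] := filter_ex (filterI wF (FE _ _ _ d0 Guw')).
rewrite (le_trans (ler_distD w'' _ _))//.
rewrite distrC in w2; rewrite (le_trans (lerD (ltW w1) w2))// mulrDr addrCA lerD2l -[leRHS](@divfK _ (1 + M)) ?gt_eqF ?addr_gt0//.
by rewrite mulrDr mulr1 [M * _]mulrC.
Unshelve. all: by end_near. Qed.

Lemma contraction_extension : exists T : V -> W,
  [/\ linear T, forall v, `|T v| <= M * `|v| & forall v w, G v w -> T v = w].
Proof.
have [T TG] := choice value_exists.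
have G0 : G 0 0.
  have [u [w [Guw _]]] := G_near 0 ltr01.
  by have := G_linear (-1) Guw Guw; rewrite !scaleN1r !addNr.
exists T; split.
- move=> c x y; apply/eqP; rewrite -subr_eq0 -normr_le0.
  apply/ler_addgt0Pr => eps eps0; rewrite add0r.
  (* The defect of linearity splits into two errors, [H1] and [H2] below, each at most
     [M * (|c| + 1) * (eps / D)], which is half of [eps]. *)
  pose D := 2%:R * M * (`|c| + 1).
  have D0 : 0 < D by rewrite !mulr_gt0// ltr_wpDl.
  have d0 : 0 < eps / D by rewrite divr_gt0.
  have [u [w [Guw xu]]] := G_near x d0.
  have [u' [w' [Guw' yu']]] := G_near y d0.
  have H1 := TG (c *: x + y) _ _ (G_linear c Guw Guw').
  have H2 := TG x _ _ Guw; have H3 := TG y _ _ Guw'.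
  have E : `|c *: (x - u) + (y - u')| <= (`|c| + 1) * (eps / D).
    rewrite (le_trans (ler_normD _ _))// normrZ mulrDl mul1r lerD ?(ltW yu')//.
    by rewrite ler_wpM2l// ltW.
  have {}H1 : `|T (c *: x + y) - (c *: w + w')| <= M * ((`|c| + 1) * (eps / D)).
    by rewrite (le_trans H1)// ler_pM2l// opprD addrACA -scalerBr.
  have {}H2 : `|c *: (T x - w) + (T y - w')| <= M * ((`|c| + 1) * (eps / D)).
    rewrite (le_trans (ler_normD _ _))// normrZ mulrDl mul1r mulrDr lerD//.
      rewrite mulrCA ler_wpM2l// (le_trans H2)// ler_pM2l// ltW//.
    by rewrite (le_trans H3)// ler_pM2l// ltW.
  rewrite (_ : _ - _ = T (c *: x + y) - (c *: w + w')
                       - (c *: (T x - w) + (T y - w'))); last first.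
    rewrite scalerBr (addrACA (c *: T x)) -opprD [in RHS]opprB.
    by rewrite addrA subrK.
  rewrite (le_trans (ler_normB _ _))// (le_trans (lerD H1 H2))//.
  rewrite -mulr2n -mulr_natl !mulrA.
  by rewrite -/D mulrAC divff ?mul1r ?gt_eqF.
(* Comparison with the pair [G 0 0] is the norm bound. *)
- by move=> v; have := TG v _ _ G0; rewrite !subr0.
- move=> v w Gvw; apply/eqP; rewrite -subr_eq0 -normr_le0.
  by have := TG v _ _ Gvw; rewrite subrr normr0 mulr0.
Qed.

End contraction_extension.

(** * Bounded operators: density, products, limits *)

Section bounded_operator_theory.
Context {R : realType}.

Lemma bounded_linear_is_bop (V : normedModType R[i]) (T : V -> V) (M : R[i]) :
  0 < M -> linear T -> (forall v, `|T v| <= M * `|v|) -> T \in @is_bop R V.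
Proof.
move=> M0 Tl TM; apply/is_bopP; split => //.
pose TL := GRing.isLinear.Build _ _ _ _ T Tl.
pose f : {linear V -> V} := HB.pack T TL.
apply: (linear_bounded_continuous f).1.
apply/linear_boundedP; exists M; split; first exact: gtr0_real.
by move=> r Mr v; rewrite (le_trans (TM v))// ler_wpM2r// ltW.
Qed.

(** The kernel of [A - B] is a closed subspace. *)
Lemma bop_eq_on_closure_lspan (V : normedModType R[i]) (A B : bop V) (S : set V) :
  {in S, A =1 B} -> {in closure (lspan S), A =1 B}.
Proof.
move=> AB v; rewrite inE => Sv; apply/eqP; rewrite -subr_eq0; apply/eqP.
have cl : closed ((A - B : bop V) @^-1` [set 0]).
  apply: preimage_closed => [x _|]; first exact: bop_continuous.
  exact/accessible_closed_set1/hausdorff_accessible/norm_hausdorff.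
suff : lspan S `<=` (A - B : bop V) @^-1` [set 0].
  by move=> /closureS/(_ _ Sv); rewrite -(closure_id _).1.
move=> _ [n [c [a [Sa ->]]]]; rewrite /= -[LHS]/(A _ - B _).
rewrite (linear_sum A) (linear_sum B) -sumrB big1// => i _.
by rewrite (linearZ_LR A) (linearZ_LR B)/= AB ?inE// subrr.
Qed.

Lemma bop_mulE (V : normedModType R[i]) (A B : bop V) v : (A * B) v = A (B v).
Proof. by []. Qed.

Lemma bop_scaler_mull (V : normedModType R[i]) (c : R[i]) (A B : bop V) :
  (c *: A) * B = c *: (A * B).
Proof. exact: bop_eq. Qed.

Lemma bop_scaler_mulr (V : normedModType R[i]) (c : R[i]) (A B : bop V) :
  A * (c *: B) = c *: (A * B).
Proof. by apply: bop_eq => v; rewrite bop_mulE !bopZE linearZ. Qed.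

Lemma opnormM (V : normedModType R[i]) (A B : bop V) : `|A * B| <= `|A| * `|B|.
Proof.
apply: opnorm_le => [|v]; first by rewrite mulr_ge0.
rewrite (le_trans (opnormP A (B v)))// -mulrA ler_wpM2l ?opnorm_ge0//.
exact: opnormP.
Qed.

Lemma continuous_bop_conj (V : normedModType R[i]) (c : R[i]) (A B : bop V) :
  continuous (fun X : bop V => c *: (A * X * B)).
Proof.
pose f (X : bop V) := c *: (A * X * B).
have fl : linear f.
  move=> d X Y; rewrite /f mulrDr mulrDl scalerDr bop_scaler_mulr.
  by rewrite bop_scaler_mull !scalerA mulrC.
pose fL := GRing.isLinear.Build _ _ _ _ f fl.
pose F : {linear bop V -> bop V} := HB.pack f fL.
apply: (linear_bounded_continuous F).1; apply/linear_boundedP.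
exists (`|c| * (`|A| * `|B|)); split => [|r Mr X]; first exact: ger0_real.
rewrite /= /f normrZ (le_trans _ (ler_wpM2r _ (ltW Mr)))// -[leRHS]mulrA ler_wpM2l//.
rewrite (le_trans (opnormM _ _))// [leRHS]mulrAC ler_wpM2r// opnormM//.
Qed.

(* [limn u] is [point] when [u] diverges, which [phi] must fix; with it no proof
   that the series defining [markov_op] converges is required. *)
Lemma lim_cancel (V : normedModType R[i]) (phi psi : V -> V) (u : nat -> V) :
  continuous phi -> continuous psi -> cancel phi psi -> phi point = point ->
  limn (phi \o u) = phi (limn u).
Proof.
move=> phic psic phiK phi0; have [cu|ncu] := pselect (cvgn u).
  apply: cvg_lim; first exact: norm_hausdorff.
  by apply: continuous_cvg => //; exact: phic.
rewrite (dvgP ncu) phi0 dvgP// => /cvg_ex[l ul]; apply: ncu.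
apply/cvg_ex; exists (psi l).
have -> : u = psi \o (phi \o u) by apply/funext => n /=; rewrite phiK.
by apply: continuous_cvg => //; exact: psic.
Qed.

End bounded_operator_theory.

(** * Operators on a Hilbert space defined through Gram matrices *)

Section hilbert_theory.
Context {R : realType} {V : hilbertType R}.

Lemma dotp_suml (I : Type) (r : seq I) (f : I -> V) v :
  dotp (\sum_(i <- r) f i) v = \sum_(i <- r) dotp (f i) v.
Proof. by rewrite /dotp linear_sumlz. Qed.

Lemma dotp_sumr (I : Type) (r : seq I) (f : I -> V) v :
  dotp v (\sum_(i <- r) f i) = \sum_(i <- r) dotp v (f i).
Proof. by rewrite /dotp linear_sum. Qed.

Lemma dotpZl c (u v : V) : dotp (c *: u) v = c * dotp u v.
Proof. by rewrite /dotp linearZl_LR. Qed.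

Lemma dotpZr c (u v : V) : dotp u (c *: v) = Num.conj c * dotp u v.
Proof. by rewrite /dotp linearZr_LR. Qed.

Lemma dotpBr (u v w : V) : dotp u (v - w) = dotp u v - dotp u w.
Proof. by rewrite /dotp linearB. Qed.

(* If [w] is orthogonal to [S], then [`|w| <= `|w - v|] for [v] in the span, by
   Pythagoras. *)
Lemma orthogonal_total_eq0 (S : set V) (w : V) :
  closure (lspan S) = setT -> (forall v, S v -> dotp v w = 0) -> w = 0.
Proof.
move=> ST Sw; apply/eqP; rewrite -normr_le0; apply/ler_addgt0Pr => eps eps0.
rewrite add0r.
have : closure (lspan S) w by rewrite ST.
move=> /(_ _ (nbhsx_ballx _ _ eps0)) [v [[n [c [a [Sa vE]]]]]].
rewrite -ball_normE/= => wv; apply: le_trans (ltW wv).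
have vw : dotp v w = 0.
  by rewrite vE dotp_suml big1// => i _; rewrite dotpZl Sw ?mulr0.
have wv0 : dotp w v = 0.
  have := vw; rewrite /dotp hermC => /eqP.
  by rewrite expr0 mul1r fmorph_eq0 => /eqP.
rewrite -(@ler_pXn2r _ 2) ?nnegrE// !inner_normE dnormB.
by rewrite -/(dotp w v) wv0 rmorph0 addr0 subr0 lerDl -inner_normE exprn_ge0.
Qed.

(** Keeping the indices lets [f] be replaced by another family with the same coefficients, and lists
    turn sums of combinations into concatenations. *)
Lemma lspan_seq (I : Type) (f : I -> V) v : lspan (range f) v ->
  exists l : seq (R[i] * I), v = \sum_(p <- l) p.1 *: f p.2.
Proof.
move=> [n [c [a [fa ->]]]].
have ex_s i : exists x, f x = a i by have [x _ xE] := fa i; exists x.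
have [s sE] := choice ex_s.
exists [seq (c i, s i) | i <- index_enum 'I_n].
by rewrite big_map; apply: eq_bigr => i _; rewrite /= sE.
Qed.

(** Proportional Gram matrices make the squared norm of a combination of the [g i] equal to [k]
    times that of the same combination of the [f i], so the assignment is well defined and bounded
    on a dense subspace. *)
Lemma bop_extension (I : Type) (f g : I -> V) (k : R[i]) :
  (forall i j, dotp (g i) (g j) = k * dotp (f i) (f j)) ->
  closure (lspan (range f)) = setT ->
  exists T : bop V, forall i, T (f i) = g i.
Proof.
move=> gf fT.
pose G (v w : V) := exists l : seq (R[i] * I),
  v = \sum_(p <- l) p.1 *: f p.2 /\ w = \sum_(p <- l) p.1 *: g p.2.
have gram l : `|\sum_(p <- l) p.1 *: g p.2| ^+ 2 =
    k * `|\sum_(p <- l) p.1 *: f p.2| ^+ 2.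
  rewrite !inner_normE -!/(dotp _ _) !dotp_suml mulr_sumr; apply: eq_bigr => p _.
  rewrite !dotp_sumr mulr_sumr; apply: eq_bigr => q _.
  by rewrite !dotpZl !dotpZr gf !mulrA [k * _]mulrC; congr (_ * _); rewrite mulrAC.
(* This constant is positive even for [k = 0], and its square dominates [|k|]. *)
have M0 : 0 < 1 + `|k| by rewrite ltr_pwDl.
have [|||T [Tl TM TG]] := @contraction_extension _ V V G (1 + `|k|) M0.
- move=> c v w v' w' [l [-> ->]] [l' [-> ->]].
  exists ([seq (c * p.1, p.2) | p <- l] ++ l'); rewrite !big_cat !big_map/=.
  by rewrite !scaler_sumr; split; congr (_ + _); apply: eq_bigr => p _;
    rewrite scalerA.
- move=> v w [l [-> ->]]; rewrite -(@ler_pXn2r _ 2) ?nnegrE ?mulr_ge0 ?(ltW M0)//.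
  rewrite -[leLHS]ger0_norm ?exprn_ge0// gram normrM normrX normr_id exprMn.
  rewrite ler_wpM2r ?exprn_ge0// (@le_trans _ _ (1 + `|k|)) ?lerDr//.
  by rewrite ler_eXnr// lerDl.
- rewrite -subTset -fT; apply: closureS => v /lspan_seq[l ->].
  by exists (\sum_(p <- l) p.1 *: g p.2), l.
exists (Bop (bounded_linear_is_bop M0 Tl TM)) => i; apply: TG.
by exists [:: (1, i)]; rewrite !big_seq1 !scale1r.
Qed.

(** The default value of [get] is [point], here the zero operator. *)
Lemma adjoint_spec_or_0 (A : bop V) :
  (forall u v, dotp (A u) v = dotp u (adjoint A v)) \/ adjoint A = 0.
Proof.
rewrite /adjoint; case: xgetP => [B _ AB|_]; first by left.
by right.
Qed.

End hilbert_theory.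

(** * Creation operators, gauge unitaries and the Markov map *)

Section fock_theory.
Context {R : realType} {H : hilbertType R} (F : fockSpace H).
Implicit Types (A B : bop F) (x : H) (lambda mu : R[i]).

Lemma bop_eq_on_tens A B : (forall s, A (tens F s) = B (tens F s)) -> A = B.
Proof.
move=> AB; apply: bop_eq => v.
apply: (@bop_eq_on_closure_lspan _ _ A B (range (tens F))).
  by move=> _ /set_mem[s _ <-].
by rewrite inE tens_total.
Qed.

(** Prefixing [x] multiplies the Gram matrix of the simple tensors by [dotp x x], so [bop_extension]
    provides the operator. *)
Lemma creation_tens x s : creation F x (tens F s) = tens F (x :: s).
Proof.
rewrite /creation; case: xgetP => [L _ /= -> //|noL].
have [|L LE] := @bop_extension _ _ _ (tens F) (fun s => tens F (x :: s))
    (dotp x x) _ (tens_total F); last by case: (noL L).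
move=> t u; rewrite !tens_dot /= eqSS; case: ifP => _; last by rewrite mulr0.
by rewrite big_cons.
Qed.

(** The factors [lambda ^+ size s] preserve the Gram matrix: tensors of different lengths are
    orthogonal, and for equal lengths the factors cancel by [|lambda| = 1]. *)
Lemma gaugeP lambda n v : `|lambda| = 1 ->
  tensor_power F n v -> gauge F lambda v = lambda ^+ n *: v.
Proof.
move=> l1; rewrite /gauge; case: xgetP => [X _ /= + Fv|noX]; first exact.
have [|X XE] := @bop_extension _ _ _ (tens F)
    (fun s => lambda ^+ size s *: tens F s) 1 _ (tens_total F).
  move=> s t; rewrite dotpZl dotpZr mul1r tens_dot.
  case: eqP => [->|_]; last by rewrite !mulr0.
  by rewrite mulrA -normCK normrX l1 !expr1n mul1r.
exfalso; apply: (noX X) => /= m w Fw.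
rewrite -[RHS]/((lambda ^+ m *: (1 : bop F)) w).
apply: bop_eq_on_closure_lspan (mem_set Fw).
by move=> _ /set_mem[s /= <- <-]; rewrite XE.
Qed.

Lemma gauge_tens lambda s : `|lambda| = 1 ->
  gauge F lambda (tens F s) = lambda ^+ size s *: tens F s.
Proof.
move=> l1; apply: gaugeP => //; apply: subset_closure.
exists 1%N, (fun=> 1), (fun=> tens F s).
by rewrite big_ord1 scale1r; split => // _; exists s.
Qed.

(** Allows a missing factor on one side to be read as a gauge operator. *)
Lemma gauge1 : gauge F 1 = 1.
Proof.
by apply: bop_eq_on_tens => s; rewrite gauge_tens ?normr1// expr1n scale1r.
Qed.

Lemma gauge_mulV lambda : `|lambda| = 1 -> gauge F lambda * gauge F lambda^-1 = 1.
Proof.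
move=> l1; have l0 : lambda != 0 by rewrite -normr_eq0 l1 oner_eq0.
apply: bop_eq_on_tens => s.
rewrite bop_mulE gauge_tens ?normfV ?l1 ?invr1// linearZ/= gauge_tens// scalerA -exprMn.
by rewrite mulVf// expr1n scale1r.
Qed.

(** Creation adds one tensor factor, hence one power of [lambda]. *)
Lemma gauge_creation lambda x : `|lambda| = 1 ->
  gauge F lambda * creation F x = lambda *: (creation F x * gauge F lambda).
Proof.
move=> l1; apply: bop_eq_on_tens => s.
rewrite bopZE !bop_mulE creation_tens !gauge_tens// [in RHS]linearZ/= creation_tens.
by rewrite scalerA -exprS.
Qed.

(* The existence of adjoints is not needed: if the adjoint were the default
   value 0 of [get], both sides would vanish. *)
Lemma adjoint_creation_gauge lambda x : `|lambda| = 1 ->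
  adjoint (creation F x) * gauge F lambda =
  lambda *: (gauge F lambda * adjoint (creation F x)).
Proof.
move=> l1; have [adjE|->] := adjoint_spec_or_0 (creation F x); last first.
  by rewrite mul0r mulr0 scaler0.
apply: bop_eq_on_tens => s; set L := adjoint _ in adjE *.
rewrite bopZE !bop_mulE gauge_tens// linearZ/=.
case: s => [|y s].
  (* Creation never produces a tensor of length zero, so the image of the vacuum is orthogonal to
     all simple tensors. *)
  have -> : L (tens F [::]) = 0.
    apply: (orthogonal_total_eq0 (tens_total F)) => _ [t _ <-].
    by rewrite -adjE creation_tens tens_dot.
  by rewrite !raddf0.
(* [L] strips the first factor; the conjugate appears because [dotp] is conjugate-linear on the
   right. *)
have -> : L (tens F (y :: s)) = Num.conj (dotp x y) *: tens F s.
  apply/eqP; rewrite -subr_eq0; apply/eqP.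
  apply: (orthogonal_total_eq0 (tens_total F)) => _ [t _ <-].
  rewrite dotpBr -adjE creation_tens dotpZr !tens_dot conjCK /= eqSS.
  by case: ifP => _; rewrite ?mulr0 ?subrr// big_cons subrr.
by rewrite (linearZ_LR (gauge F lambda))/= gauge_tens// !scalerA mulrAC -exprS mulrC.
Qed.

(** Scaling by a nonzero [c] is invertible, so [lim_cancel] carries it through the limit. *)
Lemma markov_opZ (Theta : set nat) (e : nat -> H) (omega : nat -> R) (c : R[i]) A :
  c != 0 -> markov_op F Theta e omega (c *: A) = c *: markov_op F Theta e omega A.
Proof.
move=> c0; rewrite /markov_op.
rewrite -(@lim_cancel _ _ (fun X => c *: X) (fun X => c^-1 *: X)); first last.
- exact: scaler0.
- by move=> X; rewrite scalerA mulVf// scale1r.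
- exact: scaler_continuous.
- exact: scaler_continuous.
congr (lim (_ @ \oo)); apply/funext => n /=.
rewrite scaler_sumr; apply: eq_bigr => i _.
by rewrite bop_scaler_mulr bop_scaler_mull !scalerA mulrC.
Qed.

Lemma markov_op_gauge (Theta : set nat) (e : nat -> H) (omega : nat -> R)
    lambda mu A : `|lambda| = 1 -> `|mu| = 1 ->
  markov_op F Theta e omega (gauge F lambda * A * gauge F mu) =
  (lambda * mu) *:
    (gauge F lambda * markov_op F Theta e omega A * gauge F mu).
Proof.
move=> l1 m1.
have l1' : `|lambda^-1| = 1 by rewrite normfV l1 invr1.
have m1' : `|mu^-1| = 1 by rewrite normfV m1 invr1.
have lm0 : lambda * mu != 0 by rewrite -normr_eq0 normrM l1 m1 mulr1 oner_eq0.
pose phi X := (lambda * mu) *: (gauge F lambda * X * gauge F mu).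
(* [psi] undoes [phi], as [lim_cancel] asks; what remains is an identity of partial sums. *)
pose psi X := (lambda * mu)^-1 *: (gauge F lambda^-1 * X * gauge F mu^-1).
rewrite -[RHS]/(phi _) /markov_op -(@lim_cancel _ _ phi psi); first last.
- by rewrite /phi -[point]/(0 : bop F) mulr0 mul0r scaler0.
- move=> X; rewrite /psi /phi bop_scaler_mulr bop_scaler_mull scalerA mulVf//.
  rewrite scale1r !mulrA; have := gauge_mulV l1'; rewrite invrK => ->.
  by rewrite mul1r -mulrA gauge_mulV// mulr1.
- exact: continuous_bop_conj.
- exact: continuous_bop_conj.
congr (lim (_ @ \oo)); apply/funext => n.
rewrite /= /phi mulr_sumr mulr_suml scaler_sumr; apply: eq_bigr => i _.
rewrite bop_scaler_mulr bop_scaler_mull scalerA mulrC -scalerA; congr (_ *: _).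
(* [lambda] comes from the annihilation operator on the left, [mu] from the creation operator on the
   right. *)
rewrite !mulrA adjoint_creation_gauge// -mulrA gauge_creation//.
by rewrite bop_scaler_mulr !bop_scaler_mull scalerA mulrC !mulrA.
Qed.

Lemma iter_markov_op_gauge (Theta : set nat) (e : nat -> H) (omega : nat -> R)
    lambda mu A m : `|lambda| = 1 -> `|mu| = 1 ->
  iter m (markov_op F Theta e omega) (gauge F lambda * A * gauge F mu) =
  (lambda * mu) ^+ m *:
    (gauge F lambda * iter m (markov_op F Theta e omega) A * gauge F mu).
Proof.
move=> l1 m1; elim: m => [|m IH]; first by rewrite expr0 scale1r.
rewrite iterS IH markov_opZ ?markov_op_gauge// ?scalerA ?exprSr//.
by rewrite expf_neq0// -normr_eq0 normrM l1 m1 mulr1 oner_eq0.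
Qed.

End fock_theory.

(** * Both sides of the product formula as strong limits of one sequence *)

Theorem mainTheorem7 (R : realType) (H : hilbertType R)
    (Theta : set nat)
    (hTheta : (exists2 n : nat, (1 < n)%N & Theta = `I_n) \/ Theta = [set: nat])
    (e : nat -> H) (he : orthonormal_basis Theta e)
    (omega : nat -> R) (omega_gt0 : forall i, Theta i -> 0 < omega i)
    (omega_sum : (\sum_(0 <= i <oo | i \in Theta) (omega i)%:E = 1)%E)
    (F : fockSpace H)
    (circ : bop F -> bop F -> bop F)
    (hcirc : is_peripheral_product (markov_op F Theta e omega) circ)
    (a b : bop F)
    (ha : poisson_boundary (markov_op F Theta e omega) a)
    (hb : poisson_boundary (markov_op F Theta e omega) b)
    (lambda mu : R[i])
    (hlambda : `|lambda| = 1) (lambda_neq1 : lambda != 1)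
    (hmu : `|mu| = 1) (mu_neq1 : mu != 1) :
  circ (gauge F lambda * a) (b * gauge F mu)
  = gauge F lambda * circ a b * gauge F mu.
Proof.
set P := markov_op F Theta e omega in hcirc ha hb *.
have n1 : `|1 : R[i]| = 1 by exact: normr1.
have La : eigenop P lambda (gauge F lambda * a).
  have := markov_op_gauge Theta e omega a hlambda n1.
  by rewrite gauge1 !mulr1 -/P ha scale1r.
have bM : eigenop P mu (b * gauge F mu).
  have := markov_op_gauge Theta e omega b n1 hmu.
  by rewrite gauge1 !mul1r -/P hb scale1r.
have lm0 m : (lambda * mu) ^+ m != 0.
  by rewrite expf_neq0// -normr_eq0 normrM hlambda hmu mulr1 oner_eq0.
have lhs_cvg := circ_sot hcirc hlambda hmu La bM.
(* The factor [(1 * 1) ^- m] matches [circ_sot] for [a] and [b], both of eigenvalue [1]. *)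
have prodE : (fun m => (lambda * mu) ^- m *:
      iter m P (gauge F lambda * a * (b * gauge F mu))) =
    (fun m => gauge F lambda * ((1 * 1) ^- m *: iter m P (a * b)) * gauge F mu).
  apply/funext => m; rewrite mulr1 expr1n invr1 scale1r !mulrA -(mulrA _ a).
  by rewrite iter_markov_op_gauge// scalerA mulVf// scale1r.
rewrite prodE in lhs_cvg.
apply: bop_eq => v; apply: (cvg_unique (@norm_hausdorff _ F) (lhs_cvg v)).
have rhs_cvg : sot_cvg _ _ := circ_sot hcirc n1 n1 ha hb.
(* Strong convergence is used at the vector [gauge F mu v], then pushed through the continuous
   [gauge F lambda]. *)
exact: (continuous_cvg _ (@bop_continuous _ _ (gauge F lambda) _)
  (rhs_cvg (gauge F mu v))).
Qed.
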